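(* Cut elimination for simple proof nets preserves correctness, is confluent, and is terminating.
   Context: Work in unit-free classical propositional logic with formulas generated by $F ::= a \mid \bar a \mid F\vee F \mid F\wedge F$ ($a$ ranging over propositional variables, $\bar a$ their duals, negation pushed to atoms). A cut is treated as a special formula $A \mathbin{\text{cut}} \bar A$ occurring only at the root of a tree. A simple prenet $\pi$ consists of a sequent forest $\Gamma$ (a list of formula trees, possibly including cuts) together with a symmetric, irreflexive binary relation $P$ (the identity links) on its set of leaves (atom occurrences) such that any two related atom occurrences are dual to each other; an atom may be linked to zero, one, or several others, but there is at most one link between any pair. A conjunctive pruning of $\pi$ is obtained by deleting, for every $\wedge$-node and every cut, one of its two immediate subformulas, and restricting $P$ to the remaining leaves. A simple prenet is correct (obeys the pruning condition) iff every conjunctive pruning still contains at least one identity link; correct simple prenets are called simple proof nets. Cut elimination on simple prenets is given by the following reductions: (1) a cut between $A\wedge B$ and $\bar B\vee\bar A$ is replaced by two cuts, one between $A$ and $\bar A$ and one between $B$ and $\bar B$; (2) an atomic cut between $a$ and $\bar a$ is removed, and every atom $\bar a$ linked to the cut occurrence of $a$ becomes linked to every atom $a$ linked to the cut occurrence of $\bar a$ (if one of the cut atoms has no links, no new links arise; a link between the two cut atoms themselves is simply removed with the cut). *)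

(* Defs.v *)
From mathcomp Require Import all_boot.
From Stdlib Require Import Relation_Operators.

Set Implicit Arguments.
Unset Strict Implicit.
Unset Printing Implicit Defensive.

Section SimpleNets.

Variable V : Type.

Inductive formula : Type :=
| Atom of V
| Coatom of V
| Or of formula & formula
| And of formula & formula.

Fixpoint dual (A : formula) : formula :=
  match A with
  | Atom a => Coatom a
  | Coatom a => Atom a
  | Or A B => And (dual B) (dual A)
  | And A B => Or (dual B) (dual A)
  end.

Definition atomic (A : formula) : bool :=
  match A with Atom _ | Coatom _ => true | _ => false end.

(* [Cut A] is the tree of the cut between [A] (left) and [dual A] (right). *)
Inductive tree : Type :=
| Form of formula
| Cut of formula.

(* Nodes of a tree are addressed by their paths from the root; [false] descends to
   the left immediate subformula and [true] to the right one. *)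
Definition position := seq bool.

(* The atom at the leaf of address [p]; [None] if [p] is not a leaf. *)
Fixpoint formula_leaf (A : formula) (p : position) : option formula :=
  match A, p with
  | Atom _, [::] | Coatom _, [::] => Some A
  | Or B C, s :: q | And B C, s :: q => formula_leaf (if s then C else B) q
  | _, _ => None
  end.

Definition tree_leaf (t : tree) (p : position) : option formula :=
  match t, p with
  | Form A, _ => formula_leaf A p
  | Cut A, s :: q => formula_leaf (if s then dual A else A) q
  | Cut _, [::] => None
  end.

(* A node of a forest: the index of its tree in the list, and its path. *)
Definition address := (nat * position)%type.

Definition forest_leaf (G : seq tree) (x : address) : option formula :=
  obind (fun t => tree_leaf t x.2) (onth G x.1).

(* The links are given on all addresses; [simple_prenet] confines them to the
   leaves of the forest, so that they are a relation on these leaves. *)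
Record linked_forest : Type := LinkedForest {
  forest : seq tree;
  links : rel address
}.

Definition simple_prenet (pi : linked_forest) : Prop :=
  [/\ symmetric (links pi),
      irreflexive (links pi)
    & forall x y, links pi x y ->
        exists2 A, forest_leaf (forest pi) x = Some A
                 & forest_leaf (forest pi) y = Some (dual A)].

(* A conjunctive pruning is given by a choice [c] of the immediate subformula
   that is kept at each node; only its values at conjunctions and cuts matter.
   A leaf remains iff every conjunction or cut above it keeps its side. *)
Fixpoint formula_kept (c : position -> bool) (A : formula) (p : position) : bool :=
  match A, p with
  | Atom _, [::] | Coatom _, [::] => true
  | Or B C, s :: q =>
      formula_kept (fun r => c (s :: r)) (if s then C else B) q
  | And B C, s :: q =>
      (c [::] == s) && formula_kept (fun r => c (s :: r)) (if s then C else B) q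
  | _, _ => false
  end.

Definition tree_kept (c : position -> bool) (t : tree) (p : position) : bool :=
  match t, p with
  | Form A, _ => formula_kept c A p
  | Cut A, s :: q =>
      (c [::] == s) &&
      formula_kept (fun r => c (s :: r)) (if s then dual A else A) q
  | Cut _, [::] => false
  end.

Definition forest_kept (c : address -> bool) (G : seq tree) (x : address) :
    bool :=
  if onth G x.1 is Some t then tree_kept (fun p => c (x.1, p)) t x.2 else false.

Definition correct (pi : linked_forest) : Prop :=
  forall c : address -> bool, exists x y : address,
    [/\ links pi x y, forest_kept c (forest pi) x & forest_kept c (forest pi) y].

Definition simple_net (pi : linked_forest) : Prop :=
  simple_prenet pi /\ correct pi.

(* The n-th tree, a cut between [A o B] and [dual B o' dual A], is replaced by
   [:: Cut A; Cut B]. This maps each leaf of the new forest to the leaf of the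
   old forest that it comes from: [A] and [dual A] were reached by the paths
   left-left and right-right, [B] and [dual B] by left-right and right-left. *)
Definition split_origin (n : nat) (x : address) : address :=
  let: (i, p) := x in
  if i < n then x else
  match i - n, p with
  | 0, s :: q => (n, [:: s, s & q])
  | 1, s :: q => (n, [:: s, ~~ s & q])
  | k, _ => (n + k.-1, p)
  end.

Definition split_links (n : nat) (P : rel address) : rel address :=
  fun x y => P (split_origin n x) (split_origin n y).

(* Same, when the n-th tree is removed. *)
Definition removal_origin (n : nat) (x : address) : address :=
  if x.1 < n then x else (x.1.+1, x.2).

Definition removal_links (n : nat) (P : rel address) : rel address :=
  fun x y =>
    let x' := removal_origin n x in
    let y' := removal_origin n y in
    let l := (n, [:: false]) in
    let r := (n, [:: true]) in
    [|| P x' y', P x' l && P r y' | P x' r && P l y'].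

Inductive cut_step : linked_forest -> linked_forest -> Prop :=
| CutAnd G D A B P :
    cut_step (LinkedForest (G ++ Cut (And A B) :: D) P)
             (LinkedForest (G ++ [:: Cut A, Cut B & D]) (split_links (size G) P))
| CutOr G D A B P :
    cut_step (LinkedForest (G ++ Cut (Or A B) :: D) P)
             (LinkedForest (G ++ [:: Cut A, Cut B & D]) (split_links (size G) P))
| CutAtom G D A P : atomic A ->
    cut_step (LinkedForest (G ++ Cut A :: D) P)
             (LinkedForest (G ++ D) (removal_links (size G) P)).

Definition cut_steps : linked_forest -> linked_forest -> Prop :=
  clos_refl_trans linked_forest cut_step.

End SimpleNets.

(* Main.v *)
(** Termination: each step decreases the total size of the cut formulas.

    Confluence: two steps on distinct cuts commute, so a diamond property holds.
    For two atomic cuts, the resulting links are the paths of old links through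
    the two cuts, and the order of the steps only matters for paths crossing a
    cut twice. As links join dual atoms, both crossings have the same direction,
    and the detour between them can be skipped.

    Correctness: for every pruning of the reduct there are prunings of the
    original prenet whose leaves, outside the reduced atomic cut, all remain in
    the former. *)

Require Import Defs.
From mathcomp Require Import all_boot.
From mathcomp Require Import zify.
From Stdlib Require Import FunctionalExtensionality Relation_Operators.
From Stdlib Require Import Operators_Properties.

Set Implicit Arguments.
Unset Strict Implicit.
Unset Printing Implicit Defensive.

(** * Relinking through a cut, and how steps at two indices renumber addresses *)

Section Origins.

Implicit Types (P : rel address) (x y : address) (n m : nat).

(** The relinking of an atomic cut with ends [l] and [r], freed from renumbering: two such cuts can
    then be composed over the addresses of a single forest. *)
Definition bypass (l r : address) P : rel address :=
  fun x y => [|| P x y, P x l && P r y | P x r && P l y].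

Lemma removal_linksE n P x y :
  removal_links n P x y =
  bypass (n, [:: false]) (n, [:: true]) P (removal_origin n x) (removal_origin n y).
Proof. by []. Qed.

Lemma bypass_sym l r P : symmetric P -> symmetric (bypass l r P).
Proof.
move=> symP x y.
rewrite /bypass (symP x y) (symP x l) (symP x r) (symP l y) (symP r y).
by congr (_ || _); rewrite orbC; congr (_ || _); apply: andbC.
Qed.

Lemma bypass_comm_sub (pol : address -> bool) P l1 r1 l2 r2 x y :
  (forall u v, P u v -> pol u != pol v) -> pol l1 != pol r1 -> pol l2 != pol r2 ->
  bypass l2 r2 (bypass l1 r1 P) x y -> bypass l1 r1 (bypass l2 r2 P) x y.
Proof.
move=> polP pol1 pol2.
(* Crossing the first cut in opposite directions, with the second cut in between, would link both
   ends of the second cut to one same leaf, and so give them equal polarity. *)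
have nopath u v w : P u v -> P w u -> pol v != pol w -> False.
  by move=> /polP + /polP; case: (pol u) (pol v) (pol w) => [] [] [].
have pol1' : pol r1 != pol l1 by rewrite eq_sym.
have pol2' : pol r2 != pol l2 by rewrite eq_sym.
rewrite /bypass; case/or3P=> [/or3P[]|/andP[]|/andP[]].
- by move=> ->.
- by case/andP=> -> ->; rewrite !(orbT, andbT).
- by case/andP=> -> ->; rewrite !(orbT, andbT).
(* These paths cross the second cut. If they cross the first one both before and after, then either
   [nopath] excludes them or the outer links [a] and [b'] already make a path through the first cut
   alone. *)
all: case/or3P=> [a|/andP[a a']|/andP[a a']];
  case/or3P=> [b|/andP[b b']|/andP[b b']];
  try (by case: (nopath _ _ _ a' b));
  by rewrite ?a ?a' ?b ?b' ?(orbT, andbT).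
Qed.

Lemma bypass_comm (pol : address -> bool) P l1 r1 l2 r2 x y :
  (forall u v, P u v -> pol u != pol v) -> pol l1 != pol r1 -> pol l2 != pol r2 ->
  bypass l2 r2 (bypass l1 r1 P) x y = bypass l1 r1 (bypass l2 r2 P) x y.
Proof. by move=> *; apply/idP/idP; apply: (bypass_comm_sub (pol := pol)). Qed.

(** [b] is false for the new cut on [A] and true for that on [B]. As [dual] swaps immediate
    subformulas, on side [s] of the old cut they come from the children [s] and [~~ s]. *)
Definition split_path (b : bool) (p : position) : position :=
  if p is s :: q then [:: s, s (+) b & q] else [::].

Lemma split_originE n i p :
  split_origin n (i, p) =
  if i < n then (i, p) else if i == n then (n, split_path false p)
  else if i == n.+1 then (n, split_path true p) else (i.-1, p).
Proof.
rewrite /split_origin; case: ltnP => // le_ni.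
have -> : i = n + (i - n) by lia.
rewrite addKn; case: (i - n) => [|[|k]].
- rewrite addn0 eqxx; case: p => [|s q] /=; first by rewrite ?addn0.
  by rewrite addbF.
- rewrite addn1 eqxx ifN; last by lia.
  case: p => [|s q] /=; first by rewrite ?addn0.
  by rewrite addbT.
- rewrite !ifN; try lia.
  by congr (_, _); lia.
Qed.

Lemma split_origin_lt n i p : i < n -> split_origin n (i, p) = (i, p).
Proof. by rewrite split_originE => ->. Qed.

Lemma split_origin_gt n i p : n.+1 < i -> split_origin n (i, p) = (i.-1, p).
Proof. by move=> ?; rewrite split_originE !ifN //; lia. Qed.

Lemma removal_originE n i p :
  removal_origin n (i, p) = if i < n then (i, p) else (i.+1, p).
Proof. by []. Qed.

Ltac origins :=
  rewrite ?(split_originE, removal_originE);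
  repeat (case: ifP => ? //; rewrite ?(split_originE, removal_originE));
  try (by congr (_, _); lia); try lia.

(** Origins lead from the reduct back to the start, so the step performed last is applied first. In
    this lemma and the next three, the index of the right-hand step goes up by one after a split at
    [n] and down by one after a removal at [n]. *)
Lemma split_split_origin n m x : n < m ->
  split_origin n (split_origin m.+1 x) = split_origin m (split_origin n x).
Proof. by case: x => i p ltnm; origins. Qed.

Lemma split_removal_origin n m x : n < m ->
  split_origin n (removal_origin m.+1 x) = removal_origin m (split_origin n x).
Proof. by case: x => i p ltnm; origins. Qed.

Lemma removal_split_origin n m x : n <= m ->
  removal_origin n (split_origin m x) = split_origin m.+1 (removal_origin n x).
Proof. by case: x => i p ltnm; origins. Qed.

Lemma removal_removal_origin n m x : n <= m ->
  removal_origin n (removal_origin m x) = removal_origin m.+1 (removal_origin n x).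
Proof. by case: x => i p ltnm; origins. Qed.

End Origins.

(** * Reductions separated from their context *)

Section Contractions.

Variable V : Type.
Implicit Types (A B : formula V) (t : tree V) (G H D : seq (tree V)).
Implicit Types (P : rel address) (x y : address).

Definition junction (conj : bool) A B := if conj then And A B else Or A B.

(** Merging the two logical reductions and abstracting the action on links over the index of the cut
    leaves four cases, not nine, when two steps are commuted. *)
Inductive contraction :
    tree V -> seq (tree V) -> (nat -> rel address -> rel address) -> Prop :=
| ContractSplit conj A B :
    contraction (Cut (junction conj A B)) [:: Cut A; Cut B] split_links
| ContractAtom A : atomic A -> contraction (Cut A) [::] removal_links.

Lemma cut_stepP pi pi' :
  cut_step pi pi' <->
  exists G t D ts op, [/\ contraction t ts op, forest pi = G ++ t :: D
    & pi' = LinkedForest (G ++ ts ++ D) (op (size G) (links pi))].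
Proof.
split=> [[G D A B P | G D A B P | G D A P atomA] | ].
- by do 5!eexists; split; first exact: (ContractSplit true A B).
- by do 5!eexists; split; first exact: (ContractSplit false A B).
- by do 5!eexists; split; first exact: (ContractAtom atomA).
- case: pi => F P [G [t [D [ts [op [c /= -> ->]]]]]].
  case: {t ts op} c => [[] A B | A atomA].
  + exact: CutAnd.
  + exact: CutOr.
  + exact: CutAtom.
Qed.

(** The shape of the cut formula determines the reduction, so two steps on the same cut give the
    same reduct. *)
Lemma contraction_fun t ts ts' op op' :
  contraction t ts op -> contraction t ts' op' -> ts = ts' /\ op = op'.
Proof.
move=> c; case: {t ts op} c => [conj A B | A atomA] c'; move: c'.
  set t := Cut _ => c'; move Dt: t c' => t' c'.
  case: {t' ts' op'} c' Dt => [conj' A' B' | A' atomA']; rewrite {}/t.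
    by case: conj conj' => [] [] // [-> ->].
  by case: conj => // -[eqA]; rewrite -eqA in atomA'.
set t := Cut A => c'; move Dt: t c' => t' c'.
case: {t' ts' op'} c' Dt => [conj' A' B' | A' atomA'] //; rewrite {}/t.
by case: conj' => // -[eqA]; rewrite eqA in atomA.
Qed.

(** * Leaves, polarities and preservation of prenets *)

Lemma onth_catl G H i : i < size G -> onth (G ++ H) i = onth G i.
Proof. by rewrite onth_cat => ->. Qed.

Lemma onth_catr G H k : onth (G ++ H) (size G + k) = onth H k.
Proof. by rewrite onth_cat ltnNge leq_addr addKn. Qed.

Lemma onth_cat0 G D t : onth (G ++ t :: D) (size G) = Some t.
Proof. by rewrite -[size G]addn0 onth_catr. Qed.

Lemma forest_leafE G i p :
  forest_leaf G (i, p) = obind (fun t => tree_leaf t p) (onth G i).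
Proof. by []. Qed.

Lemma split_leaf G D conj A B x :
  forest_leaf (G ++ [:: Cut A, Cut B & D]) x =
  forest_leaf (G ++ Cut (junction conj A B) :: D) (split_origin (size G) x).
Proof.
case: x => i p; rewrite split_originE.
case: ltnP => [ltiG | leGi]; first by rewrite !forest_leafE !onth_catl.
rewrite -(subnKC leGi); case: (i - size G) => [|[|k]].
- rewrite addn0 eqxx !forest_leafE !onth_cat0 /=.
  by case: p => [|[] q] //=; case: conj.
- rewrite addn1 eqxx ifN; last by lia.
  rewrite -addn1 !forest_leafE onth_cat0 onth_catr /=.
  by case: p => [|[] q] //=; case: conj.
- rewrite !ifN; try lia.
  by rewrite addnS /= -addnS !forest_leafE !onth_catr.
Qed.

Lemma removal_leaf G D t x :
  forest_leaf (G ++ D) x = forest_leaf (G ++ t :: D) (removal_origin (size G) x).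
Proof.
case: x => i p; rewrite removal_originE.
case: ltnP => [ltiG | leGi]; first by rewrite !forest_leafE !onth_catl.
by rewrite -(subnKC leGi) -addnS !forest_leafE !onth_catr.
Qed.

(* Leaves are atoms; the values at compound formulas only serve to make [dual]
   exchange the two polarities unconditionally. *)
Definition polarity A := match A with Atom _ | Or _ _ => true | _ => false end.

Lemma polarity_dual A : polarity (dual A) = ~~ polarity A.
Proof. by case: A. Qed.

Definition leaf_polarity G x :=
  if forest_leaf G x is Some A then polarity A else false.

Lemma link_polarity (pi : linked_forest V) x y :
  simple_prenet pi -> links pi x y ->
  leaf_polarity (forest pi) x != leaf_polarity (forest pi) y.
Proof.
case=> _ _ leafP /leafP[A xA yA].
by rewrite /leaf_polarity xA yA polarity_dual; case: (polarity A).
Qed.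

Lemma dualK : involutive (@dual V).
Proof. by elim=> //= A IHA B IHB; rewrite IHA IHB. Qed.

Lemma cut_leaf G D A s : atomic A ->
  forest_leaf (G ++ Cut A :: D) (size G, [:: s]) = Some (if s then dual A else A).
Proof.
by rewrite forest_leafE onth_cat0 /=; case: s; case: A.
Qed.

Lemma cut_leaf_polarity G D A : atomic A ->
  leaf_polarity (G ++ Cut A :: D) (size G, [:: false]) !=
  leaf_polarity (G ++ Cut A :: D) (size G, [:: true]).
Proof.
move=> atomA; rewrite /leaf_polarity !cut_leaf // polarity_dual.
by case: (polarity A).
Qed.

Lemma cut_step_prenet (pi pi' : linked_forest V) :
  simple_prenet pi -> cut_step pi pi' -> simple_prenet pi'.
Proof.
move=> netpi /cut_stepP[G [t [D [ts [op [c Dpi ->]]]]]].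
have polP := link_polarity netpi; case: (netpi); rewrite Dpi in polP *.
move: (links pi) polP => P polP symP irrP leafP {netpi Dpi}.
case: {t ts op} c polP leafP => [conj A B | A atomA] polP leafP; split.
- by move=> x y /=; apply: symP.
- by move=> x /=; apply: irrP.
- by move=> x y /= /leafP; rewrite -!split_leaf.
- by move=> x y; rewrite /= !removal_linksE; apply: bypass_sym.
- move=> x; rewrite /= removal_linksE /bypass irrP /=.
  have polA := cut_leaf_polarity G D atomA.
  (* A new loop would come from a leaf linked to both ends of the cut, but these have different
     polarities. *)
  apply/norP; split; apply/negP=> /andP[/polP Pu /polP Pv]; move: polA Pu Pv;
  by do 3!case: (leaf_polarity _ _).
- move=> x y; rewrite /= removal_linksE !(removal_leaf G D (Cut A)).
  case/or3P=> [/leafP // | /andP[/leafP[C -> +] /leafP[E + ->]] |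
               /andP[/leafP[C -> +] /leafP[E + ->]]];
    rewrite !cut_leaf // => -[eqC] [eqE]; exists C => //; congr Some.
    by rewrite -eqE eqC dualK.
  by rewrite -eqE eqC.
Qed.

(** * Prunings and preservation of correctness *)

Lemma forest_keptE c G i p :
  forest_kept c G (i, p) =
  if onth G i is Some t then tree_kept (fun q => c (i, q)) t p else false.
Proof. by []. Qed.

Lemma split_kept c' G D conj A B :
  exists c, forall x, forest_kept c (G ++ Cut (junction conj A B) :: D) x ->
  exists2 x', x = split_origin (size G) x'
            & forest_kept c' (G ++ [:: Cut A, Cut B & D]) x'.
Proof.
pose n := size G; pose cA := c' (n, [::]); pose cB := c' (n.+1, [::]).
(* The disjunction of the old cut is kept only if both new cuts keep the parts
   that come from it; otherwise some new cut keeps a part of the conjunction. *)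
pose cn (p : position) := match p with
  | [::] => if conj then cA && cB else cA || cB
  (* When the old cut keeps its conjunction, the child from [A] must be chosen if the new cut on [A]
     keeps that side, and the child from [B] otherwise. Whether the conjunction is on the left or on
     the right, the index of this child is [cA]. *)
  | [:: s] => cA
  | [:: s, s' & q] => c' (if s == s' then n else n.+1, s :: q)
  end.
exists (fun x => let: (i, p) := x in
  if i < n then c' (i, p) else if i == n then cn p else c' (i.+1, p)).
case=> i p; rewrite forest_keptE.
have [ltiG | leGi] := ltnP i n.
  rewrite onth_catl // => kept; exists (i, p); first by rewrite split_originE ltiG.
  by rewrite forest_keptE onth_catl.
have [-> | neiG] := eqVneq i n.
  rewrite onth_cat0.
  case: p => [//|s [|s' q]]; first by case: (conj); case: s; rewrite /= andbF.
  move=> kept.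
  exists (if s == s' then n else n.+1, s :: q).
    case: eqVneq kept => [<- _ | ness' _].
      by rewrite split_originE ltnn eqxx /= addbF.
    rewrite split_originE ltnNge leqnSn /= eqn_leq ltnn eqxx /= addbT.
    by case: s s' ness' => [] [].
  have onB : onth (G ++ [:: Cut A, Cut B & D]) n.+1 = Some (Cut B).
    by rewrite -addn1 onth_catr.
  move: kept; rewrite /junction /cn; case: (conj); case: s s' => [] [];
  rewrite /= forest_keptE ?onth_cat0 ?onB /= -/cA -/cB;
  by case: (cA); case: (cB).
move=> kept; exists (i.+1, p).
  by rewrite split_originE !ifN //; lia.
move: kept; rewrite forest_keptE.
have -> : i = n + (i - n.+1).+1 by lia.
by rewrite -addnS !onth_catr.
Qed.

(** A pruning of the reduct says nothing about the removed cut, so the side [b] that is kept there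
    remains free and both choices can be tried. *)
Lemma removal_kept c' b G D A : atomic A ->
  exists c, forall x, forest_kept c (G ++ Cut A :: D) x ->
  x = (size G, [:: b]) \/
  exists2 x', x = removal_origin (size G) x' & forest_kept c' (G ++ D) x'.
Proof.
move=> atomA; pose n := size G.
exists (fun x => let: (i, p) := x in
  if i < n then c' (i, p) else if i == n then b else c' (i.-1, p)).
case=> i p; rewrite forest_keptE.
have [ltiG | leGi] := ltnP i n.
  rewrite onth_catl // => kept; right; exists (i, p).
    by rewrite removal_originE ltiG.
  by rewrite forest_keptE onth_catl.
have [-> | neiG] := eqVneq i n.
  rewrite onth_cat0 => kept; left.
  case: p kept => [|s q] //= /andP[/eqP ->].
  by case: A atomA => // a _; case: s; case: q.
move=> kept; right; exists (i.-1, p).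
  by rewrite removal_originE ifN; [congr (_, _)|]; lia.
move: kept; rewrite forest_keptE.
have -> : i = n + (i - n.+1).+1 by lia.
by rewrite onth_catr addnS /= onth_catr.
Qed.

Lemma cut_step_correct (pi pi' : linked_forest V) :
  simple_net pi -> cut_step pi pi' -> correct pi'.
Proof.
case=> [[symP irrP _]] corP /cut_stepP[G [t [D [ts [op [c Dpi ->]]]]]] c'.
rewrite /correct Dpi in corP; move: (links pi) symP irrP corP => P symP irrP corP {Dpi}.
case: {t ts op} c corP => [conj A B | A atomA] corP.
  have [c keptP] := split_kept c' G D conj A B.
  have [x [y [Pxy /keptP[x' Dx kx'] /keptP[y' Dy ky']]]] := corP c.
  by exists x', y'; split=> //; rewrite /= /split_links -Dx -Dy.
pose l (b : bool) : address := (size G, [:: b]).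
(* If no link avoiding the cut survives, keeping either side of the cut leaves a
   link to that side, and the two other ends are linked after the reduction. *)
have keptP b : (exists x y, [/\ removal_links (size G) P x y,
      forest_kept c' (G ++ D) x & forest_kept c' (G ++ D) y])
  \/ exists2 x, P (removal_origin (size G) x) (l b) & forest_kept c' (G ++ D) x.
  have [c keptP] := removal_kept c' b G D atomA.
  have [x [y [Pxy /keptP[Dx|[x' Dx kx]] /keptP[Dy|[y' Dy ky]]]]] := corP c.
  (* Only one atom of the cut is kept, so a link with both ends in the cut would be a loop. *)
  - by rewrite Dx Dy irrP in Pxy.
  - by right; exists y' => //; rewrite symP -Dy /l -Dx.
  - by right; exists x' => //; rewrite -Dx /l -Dy.
  - by left; exists x', y'; split=> //; rewrite removal_linksE /bypass -Dx -Dy Pxy.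
have [//|[x Px kx]] := keptP false; have [//|[y Py ky]] := keptP true.
exists x, y; split=> //; rewrite /= removal_linksE /bypass Px /=.
by rewrite (symP (_, _)) Py orbT.
Qed.

(** * Commutation of steps and confluence *)

Lemma contraction_comm G H D t1 ts1 op1 t2 ts2 op2 P :
  simple_prenet (LinkedForest (G ++ t1 :: H ++ t2 :: D) P) ->
  contraction t1 ts1 op1 -> contraction t2 ts2 op2 ->
  op2 (size (G ++ ts1 ++ H)) (op1 (size G) P) =
  op1 (size G) (op2 (size (G ++ t1 :: H)) P).
Proof.
(* The diamond holds up to equality of prenets, and links are functions. *)
move=> netP c1 c2; apply: functional_extensionality => x.
apply: functional_extensionality => y.
rewrite !size_cat /=; set n := size G; set k := size H.
have polP := link_polarity netP; rewrite /= in polP.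
have lt_n : n < n + k.+1 by lia.
have le_n : n <= n + k by lia.
case: {t1 ts1 op1} c1 netP polP => [conj1 A1 B1 | A1 atom1];
case: {t2 ts2 op2} c2 => [conj2 A2 B2 | A2 atom2] netP polP;
rewrite /= ?removal_linksE /split_links.
- have -> : n + (2 + k) = (n + k.+1).+1 by lia.
  by rewrite !split_split_origin.
- have -> : n + (2 + k) = (n + k.+1).+1 by lia.
  rewrite /bypass !split_removal_origin // removal_linksE /bypass.
  by rewrite !split_origin_gt //; lia.
- rewrite add0n removal_linksE addnS /bypass -!removal_split_origin //.
  by rewrite !split_origin_lt.
(* Two atomic cuts: pulled back to the addresses of the original forest, both sides become iterated
   bypasses of [P]. *)
- have pol1 := cut_leaf_polarity G (H ++ Cut A2 :: D) atom1.
  have pol2 := cut_leaf_polarity (G ++ Cut A1 :: H) D atom2.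
  rewrite -catA size_cat /= -/n -/k in pol2.
  have rem1 s : removal_origin n (n + k, [:: s]) = (n + k.+1, [:: s]).
    by rewrite removal_originE ltnNge leq_addr addnS.
  have rem2 s : removal_origin (n + k.+1) (n, [:: s]) = (n, [:: s]).
    by rewrite removal_originE lt_n.
  rewrite add0n /bypass !removal_linksE !rem1 !rem2 !(@removal_removal_origin n (n + k)) //.
  rewrite -!addnS; exact: (bypass_comm _ _ polP pol1 pol2).
Qed.

Lemma cat_cons_eq G1 t1 D1 G2 t2 D2 : G1 ++ t1 :: D1 = G2 ++ t2 :: D2 ->
  [\/ [/\ G1 = G2, t1 = t2 & D1 = D2],
      exists2 H, G2 = G1 ++ t1 :: H & D1 = H ++ t2 :: D2
    | exists2 H, G1 = G2 ++ t2 :: H & D2 = H ++ t1 :: D1].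
Proof.
elim: G1 G2 => [|s1 G1 IH] [|s2 G2] /= [].
- by move=> -> ->; constructor 1.
- by move=> -> ->; constructor 2; exists G2.
- by move=> -> <-; constructor 3; exists G1.
- move=> -> /IH[[-> -> ->]|[H -> ->]|[H -> ->]]; first by constructor 1.
    by constructor 2; exists H.
  by constructor 3; exists H.
Qed.

Lemma contraction_join G H D t1 ts1 op1 t2 ts2 op2 P :
  simple_prenet (LinkedForest (G ++ t1 :: H ++ t2 :: D) P) ->
  contraction t1 ts1 op1 -> contraction t2 ts2 op2 ->
  exists2 pi,
    cut_step (LinkedForest (G ++ ts1 ++ H ++ t2 :: D) (op1 (size G) P)) pi &
    cut_step (LinkedForest (G ++ t1 :: H ++ ts2 ++ D)
                (op2 (size (G ++ t1 :: H)) P)) pi.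
Proof.
move=> netP c1 c2.
(* The links are written with the right cut contracted first, which does not move the left cut;
   [contraction_comm] accounts for the other order. *)
exists (LinkedForest (G ++ ts1 ++ H ++ ts2 ++ D)
          (op1 (size G) (op2 (size (G ++ t1 :: H)) P))).
  apply/cut_stepP; exists (G ++ ts1 ++ H), t2, D, ts2, op2; split=> //=.
    by rewrite -!catA.
  by rewrite -!catA (contraction_comm netP c1 c2).
by apply/cut_stepP; exists G, t1, (H ++ ts2 ++ D), ts1, op1.
Qed.

Lemma cut_step_diamond (pi pi1 pi2 : linked_forest V) :
  simple_prenet pi -> cut_step pi pi1 -> cut_step pi pi2 ->
  pi1 = pi2 \/ exists2 pi3, cut_step pi1 pi3 & cut_step pi2 pi3.
Proof.
move=> netpi /cut_stepP[G1 [t1 [D1 [ts1 [op1 [c1 eq1 ->]]]]]].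
move=> /cut_stepP[G2 [t2 [D2 [ts2 [op2 [c2 eq2 ->]]]]]].
case: pi netpi eq1 eq2 => F P netP /= eqF eq2; rewrite {}eqF in netP eq2.
case: (cat_cons_eq eq2) => [[eqG eqt eqD] | [H eqG eqD] | [H eqG eqD]].
- left; rewrite -eqt in c2; have [-> ->] := contraction_fun c1 c2.
  by rewrite eqG eqD.
- right; rewrite eqG eqD in netP *.
  by rewrite -catA /=; apply: contraction_join.
- right; rewrite {}eq2 eqG eqD -catA /= in netP *.
  have [pi3 step2 step1] := contraction_join netP c2 c1.
  by exists pi3.
Qed.

Lemma cut_steps_confluent (pi pi1 pi2 : linked_forest V) :
  simple_prenet pi -> cut_steps pi pi1 -> cut_steps pi pi2 ->
  exists pi3, cut_steps pi1 pi3 /\ cut_steps pi2 pi3.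
Proof.
(* One step against many. The single step may already have been performed on the way to [rho2],
   hence the alternative of equality. Induction from the head carries [simple_prenet] along the
   reduction. *)
have strip rho rho1 rho2 : simple_prenet rho -> cut_step rho rho1 ->
    clos_refl_trans_1n _ (@cut_step V) rho rho2 ->
    exists2 rho3, cut_steps rho1 rho3 & rho2 = rho3 \/ cut_step rho2 rho3.
  move=> net step1 steps2; elim: steps2 rho1 net step1 => {rho rho2} [rho |
    rho sigma rho2 step steps2 IH] rho1 net step1.
    by exists rho1; [apply: rt_refl | right].
  have [<- | [tau step1' step']] := cut_step_diamond net step step1.
    by exists rho2; [apply: clos_rt1n_rt | left].
  have [rho3 steps3 rho3P] := IH _ (cut_step_prenet net step) step1'.
  by exists rho3 => //; apply: rt_trans steps3; apply: rt_step.
move=> net steps1; elim: (clos_rt_rt1n _ _ _ _ steps1) net pi2 => {steps1 pi1 pi} [pi |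
  pi sigma pi1 step _ IH] net pi2 steps2.
  by exists pi2; split=> //; apply: rt_refl.
have [tau steps_tau tauP] := strip _ _ _ net step (clos_rt_rt1n _ _ _ _ steps2).
have [pi3 [steps1_3 steps_3]] := IH (cut_step_prenet net step) _ steps_tau.
exists pi3; split=> //; case: tauP => [-> // | step_tau].
by apply: rt_trans steps_3; apply: rt_step.
Qed.

(** * Termination *)

Fixpoint weight A : nat :=
  match A with
  | Atom _ | Coatom _ => 1
  | Or A B | And A B => (weight A + weight B).+1
  end.

Definition cut_weight t := if t is Cut A then weight A else 0.

Definition forest_weight G := sumn (map cut_weight G).

Lemma cut_step_weight (pi pi' : linked_forest V) :
  cut_step pi pi' -> forest_weight (forest pi') < forest_weight (forest pi).
Proof.
move=> /cut_stepP[G [t [D [ts [op [c -> ->]]]]]] /=.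
rewrite /forest_weight !map_cat !sumn_cat ltn_add2l /= ltn_add2r.
(* A split loses the weight of one connective, a removal that of one atom. *)
by case: {t ts op} c => [[] A B | [] // *] /=; rewrite ?addn0.
Qed.

Lemma cut_step_wf (pi : linked_forest V) :
  Acc (fun pi2 pi1 => cut_step pi1 pi2) pi.
Proof.
have [n] := ubnP (forest_weight (forest pi)).
elim: n pi => [//|n IH] pi le_n; constructor=> pi' /cut_step_weight lt_pi.
by apply: IH; apply: leq_trans lt_pi le_n.
Qed.

End Contractions.

Theorem theorem5p9 (V : Type) :
  (forall pi pi' : linked_forest V,
     simple_net pi -> cut_step pi pi' -> simple_net pi') /\
  (forall pi pi1 pi2 : linked_forest V,
     simple_net pi -> cut_steps pi pi1 -> cut_steps pi pi2 ->
     exists pi3 : linked_forest V, cut_steps pi1 pi3 /\ cut_steps pi2 pi3) /\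
  (forall pi : linked_forest V,
     simple_net pi -> Acc (fun pi2 pi1 => cut_step pi1 pi2) pi).
Proof.
split; [|split].
- move=> pi pi' net step; split; last exact: cut_step_correct net step.
  by case: net => prenet _; apply: cut_step_prenet prenet step.
- by move=> pi pi1 pi2 [prenet _]; apply: cut_steps_confluent.
- by move=> pi _; apply: cut_step_wf.
Qed.
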